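(* Let $(\Omega,\mathcal F,(\mathcal F_t)_{t\in\mathbb N_0})$ be a filtered measurable space, $\mathcal P$ a family of probability measures on $(\Omega,\mathcal F)$, $Q$ a probability measure on $(\Omega,\mathcal F)$, and $I\in(0,\infty)$. Let $p>1$ and let $k_0\ge3$ be an integer. Define $$S_p:=\sum_{k=k_0}^\infty\frac1{k(\log k)^p},\qquad c_p:=\frac1{S_p},\qquad \alpha_k:=\frac{c_p}{k(\log k)^p}\quad(k\ge k_0).$$ For each $k\ge k_0$ let $\tau_{\alpha_k}$ be an $(\mathcal F_t)$-stopping time with values in $\mathbb N_0\cup\{\infty\}$ such that $\sup_{P\in\mathcal P}P(\tau_{\alpha_k}<\infty)\le\alpha_k$, and let $B^{(p)}_t:=\sum_{k=k_0}^\infty\mathbf 1_{\{\tau_{\alpha_k}\le t\}}$ for $t\in\mathbb N_0$. Assume that $\frac{\tau_{\alpha_k}}{\log(1/\alpha_k)}\to\frac1I$ $Q$-almost surely as $k\to\infty$. Then $S_p<\infty$, $B^{(p)}$ is a $\mathcal P$-$e$-process, and $Q$-almost surely as $t\to\infty$, $$\frac1t\log B^{(p)}_t\longrightarrow I.$$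
   Context: A nonnegative adapted process $M=(M_t)_{t\in\mathbb N_0}$ (values in $[0,\infty]$ allowed) is a $\mathcal P$-$e$-process if $\mathbb E_P[M_\sigma]\le1$ for every $P\in\mathcal P$ and every finite $(\mathcal F_t)$-stopping time $\sigma$. Conventions: $\mathbb N_0=\{0,1,2,\dots\}$, $\log0=-\infty$, $\log\infty=\infty$. *)

(* Defs.v *)
From HB Require Import structures.
From mathcomp Require Import all_boot all_order all_algebra.
From mathcomp Require Import all_classical all_reals all_analysis measurable_realfun.

Set Implicit Arguments.
Unset Strict Implicit.
Unset Printing Implicit Defensive.

Import Order.TTheory GRing.Theory Num.Theory.
Import numFieldTopology.Exports numFieldNormedType.Exports.

Local Open Scope classical_set_scope.
Local Open Scope ring_scope.
Local Open Scope ereal_scope.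

Definition filtration (d : measure_display) (T : measurableType d)
    (F : nat -> set (set T)) : Prop :=
  [/\ forall t, sigma_algebra setT (F t),
      forall t, F t `<=` measurable &
      forall s t, (s <= t)%N -> F s `<=` F t].

(* Times are elements of [option nat], [None] being the time at infinity. *)
Definition time_le (x : option nat) (t : nat) : bool :=
  if x is Some n then (n <= t)%N else false.

Definition time_EFin (R : realType) (x : option nat) : \bar R :=
  if x is Some n then n%:R%:E else +oo.

Definition stopping_time (T : Type) (F : nat -> set (set T))
    (tau : T -> option nat) : Prop :=
  forall t, F t [set w | time_le (tau w) t].

Definition adapted (R : realType) (T : Type) (F : nat -> set (set T))
    (M : nat -> T -> \bar R) : Prop :=
  forall t (A : set (\bar R)), measurable A -> F t (M t @^-1` A).

(* A finite stopping time is one that never takes the value infinity, i.e.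
   a function into [nat]. *)
Definition e_process (R : realType) (d : measure_display)
    (T : measurableType d) (F : nat -> set (set T))
    (PP : set (probability T R)) (M : nat -> T -> \bar R) : Prop :=
  [/\ forall t w, 0 <= M t w,
      adapted F M &
      forall P : probability T R, PP P ->
      forall sigma : T -> nat, stopping_time F (Some \o sigma) ->
        \int[P]_w M (sigma w) w <= 1].

Section levels.
Variables (R : realType) (p : R) (k0 : nat).

Definition level_weight (k : nat) : R := ((k%:R * (ln k%:R `^ p))^-1)%R.

Definition level_sum : \bar R := \sum_(k0 <= k <oo) (level_weight k)%:E.

(* [fine] is the identity on finite sums; [fine +oo] is 0. *)
Definition level_const : R := ((fine level_sum)^-1)%R.

Definition level (k : nat) : R := (level_const * level_weight k)%R.

End levels.

Definition stop_count (R : realType) (T : Type) (k0 : nat)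
    (tau : nat -> T -> option nat) (t : nat) (w : T) : \bar R :=
  \sum_(k0 <= k <oo) (\1_[set v | time_le (tau k v) t] w)%:E.

(* Main.v *)
(** S_p converges because (log k)^(1-p) - (log (k+1))^(1-p) dominates
  (p-1) / ((k+1) (log (k+1))^p), so its partial sums telescope.  At a finite
  stopping time sigma, monotone convergence bounds E_P[B_sigma] by
  sum_k P(tau_k < oo) <= sum_k alpha_k = 1.  For the growth rate,
  log(1/alpha_k) ~ log k, so that Q-a.s. tau_k ~ (log k) / I; hence the number
  of k with tau_k <= t is exp((I + o(1)) t). *)
Require Import Defs.
From HB Require Import structures.
From mathcomp Require Import all_boot all_order all_algebra.
From mathcomp Require Import all_classical all_reals all_analysis measurable_realfun.
From mathcomp Require Import ring lra.

Set Implicit Arguments.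
Unset Strict Implicit.
Unset Printing Implicit Defensive.

Import Order.TTheory GRing.Theory Num.Theory.
Import numFieldTopology.Exports numFieldNormedType.Exports.

Local Open Scope classical_set_scope.
Local Open Scope ring_scope.

(** * Telescoping bound for the partial sums of the weights *)

Lemma ln_ge1BV (R : realType) (x : R) : 0 < x -> 1 - x^-1 <= ln x.
Proof.
move=> x0; have xV0 : 0 < x^-1 by rewrite invr_gt0.
have := @le_ln1Dx R (x^-1 - 1).
have -> : 1 + (x^-1 - 1) = x^-1 by lra.
by rewrite lnV ?posrE// => /(_ ltac:(lra)); lra.
Qed.

(** Tangent-line inequality at b for the convex function x^(-q). After factoring out b^(-q) it
    follows from exp y >= 1 + y at y = q ln(b/a), combined with ln x >= 1 - 1/x at x = b/a. *)
Lemma powRN_sub_ge (R : realType) (q a b : R) : 0 <= q -> 0 < a -> 0 < b ->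
  q * ((b - a) / b `^ (q + 1)) <= a `^ (- q) - b `^ (- q).
Proof.
move=> q0 a0 b0.
have bq0 : 0 < b `^ (- q) by rewrite powR_gt0.
have -> : a `^ (- q) = b `^ (- q) * expR (q * ln (b / a)).
  by rewrite /powR !gt_eqF// -expRD ln_div ?posrE//; congr expR; lra.
have -> : (b - a) / b `^ (q + 1) = (1 - (b / a)^-1) * b `^ (- q).
  rewrite powRD; last by rewrite (gt_eqF b0) implybT.
  rewrite powRr1 ?ltW// powRN.
  by field; rewrite !gt_eqF// powR_gt0.
have : q * (1 - (b / a)^-1) <= q * ln (b / a).
  by rewrite ler_wpM2l// ln_ge1BV// divr_gt0.
have := expR_ge1Dx (q * ln (b / a)).
by nra.
Qed.

Lemma natr_ln_gt0 (R : realType) (k : nat) : (1 < k)%N -> 0 < ln k%:R :> R.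
Proof. by move=> k1; rewrite ln_gt0// ltr1n. Qed.

Lemma level_weight_gt0 (R : realType) (p : R) (k : nat) : (1 < k)%N ->
  0 < level_weight p k.
Proof.
move=> k1; rewrite /level_weight invr_gt0 mulr_gt0 ?powR_gt0 ?natr_ln_gt0//.
by rewrite ltr0n ltnW.
Qed.

(** The tangent bound at a = ln k, b = ln(k+1), q = p - 1; the factor 1/(k+1) comes from ln(k+1) -
    ln k >= 1 - k/(k+1). *)
Lemma level_weightS_le (R : realType) (p : R) (k : nat) : 1 < p -> (1 < k)%N ->
  (p - 1) * level_weight p k.+1 <=
  ln k%:R `^ (- (p - 1)) - ln k.+1%:R `^ (- (p - 1)).
Proof.
move=> p1 k1.
have k0 : 0 < k%:R :> R by rewrite ltr0n ltnW.
have kS0 : 0 < k.+1%:R :> R by rewrite ltr0n.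
have lk := natr_ln_gt0 R k1; have lkS := natr_ln_gt0 R (ltnW k1 : (1 < k.+1)%N).
apply: le_trans (@powRN_sub_ge _ (p - 1) _ _ _ lk lkS); last by rewrite subr_ge0 ltW.
rewrite subrK /level_weight invfM; apply: ler_wpM2l; first by rewrite subr_ge0 ltW.
apply: ler_wpM2r; first by rewrite invr_ge0 powR_ge0.
rewrite -ln_div ?posrE//; apply: le_trans (ln_ge1BV (divr_gt0 kS0 k0)).
rewrite invf_div -[X in X - _](@divff _ k.+1%:R) ?gt_eqF// -mulrBl.
by rewrite -natr1 addrAC subrr add0r mul1r.
Qed.

Lemma sum_level_weight_le (R : realType) (p : R) (k0 n : nat) :
  1 < p -> (1 < k0)%N ->
  \sum_(k0 <= k < n) level_weight p k <=
  level_weight p k0 + ln k0%:R `^ (- (p - 1)) / (p - 1).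
Proof.
move=> p1 k01; have p0 : 0 < p - 1 by rewrite subr_gt0.
have w0 := level_weight_gt0 p k01.
set f := fun k : nat => (ln k%:R : R) `^ (- (p - 1)).
have f0 k : 0 <= f k / (p - 1) by rewrite divr_ge0 ?powR_ge0 1?ltW.
have [nk|kn] := leqP n k0; first by rewrite big_geq// addr_ge0 ?f0 1?ltW.
(* The difference of [f] at k controls the weight at k+1, so the first weight stays outside the
   telescoping sum. The induction keeps the term [f (k0 + m)], which is dropped afterwards. *)
suff : forall m, \sum_(k0 <= k < k0 + m.+1) level_weight p k <=
    level_weight p k0 + (f k0 - f (k0 + m)%N) / (p - 1).
  move=> /(_ (n - k0.+1)%N); rewrite addnS -addSn subnKC//.
  move/le_trans; apply; rewrite lerD2l ler_pM2r ?invr_gt0//.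
  by rewrite gerBl powR_ge0.
elim=> [|m ih]; first by rewrite addn1 big_nat1 addn0 subrr mul0r addr0.
rewrite addnS big_nat_recr/=; last by rewrite leq_addr.
apply: le_trans (lerD ih (lexx _)) _.
rewrite -addrA lerD2l -lerBrDl -mulrBl ler_pdivlMr// mulrC.
have -> : f k0 - f (k0 + m.+1)%N - (f k0 - f (k0 + m)%N) =
          f (k0 + m)%N - f (k0 + m.+1)%N by ring.
rewrite addnS.
by apply: level_weightS_le => //; rewrite (leq_trans k01)// leq_addr.
Qed.

(** * Limits of logarithms *)

Lemma cvgr_lnn (R : realType) : ln n%:R @[n --> \oo] --> (+oo : set_system R).
Proof.
apply/cvgryPge => A.
near=> n; rewrite -(@expRK R A) ler_ln ?posrE ?expR_gt0//.
  by near: n; exact: (cvgry_ge cvgr_idn).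
by near: n; exact: (cvgry_gt cvgr_idn).
Unshelve. all: by end_near. Qed.

(** With c = e/2, ln y <= y at y = c u gives ln u <= c u - ln c, which is at most e u once u >= - ln
    c / c. *)
Lemma cvg_ln_div (R : realType) {U : Type} {G : set_system U} {FG : Filter G}
    (u : U -> R) :
  u x @[x --> G] --> +oo -> ln (u x) / u x @[x --> G] --> 0.
Proof.
move=> uoo; apply/cvgr0Pnorm_le => e e0.
have c0 : 0 < e / 2 by rewrite divr_gt0.
near=> x.
have u1 : 1 <= u x by near: x; exact: (cvgry_ge uoo).
have u0 : 0 < u x by apply: lt_le_trans u1.
have uc : - ln (e / 2) / (e / 2) <= u x by near: x; exact: (cvgry_ge uoo).
rewrite ger0_norm; last first.
  by apply: divr_ge0; [exact: ln_ge0|exact: ltW].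
rewrite ler_pdivrMr//.
have := ln_sublinear (mulr_gt0 c0 u0); rewrite lnM ?posrE//.
move: uc; rewrite ler_pdivrMr//; nra.
Unshelve. all: by end_near. Qed.

(** * Normalisation and asymptotics of the levels *)

Lemma level_sum_le (R : realType) (p : R) (k0 : nat) : 1 < p -> (1 < k0)%N ->
  (level_sum p k0 <=
   (level_weight p k0 + ln k0%:R `^ (- (p - 1)) / (p - 1))%:E)%E.
Proof.
move=> p1 k01; apply: lime_le.
  apply: is_cvg_nneseries => k k0k _.
  by rewrite lee_fin ltW// level_weight_gt0// (leq_trans k01).
by apply: nearW => n; rewrite sumEFin lee_fin sum_level_weight_le.
Qed.

Lemma level_sum_gt0 (R : realType) (p : R) (k0 : nat) : (1 < k0)%N ->
  (0 < level_sum p k0)%E.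
Proof.
move=> k01; apply: (@lt_le_trans _ _ (level_weight p k0)%:E).
  by rewrite lte_fin level_weight_gt0.
have := @nneseries_lim_ge R (fun k => (level_weight p k)%:E) xpredT k0 k0.+1.
rewrite big_nat1; apply => n k0n _.
by rewrite lee_fin ltW// level_weight_gt0// (leq_trans k01).
Qed.

Lemma level_sum_fin_num (R : realType) (p : R) (k0 : nat) :
  1 < p -> (1 < k0)%N -> level_sum p k0 \is a fin_num.
Proof.
move=> p1 k01; rewrite ge0_fin_numE; last exact/ltW/level_sum_gt0.
exact: le_lt_trans (level_sum_le p1 k01) (ltry _).
Qed.

Lemma fine_level_sum_gt0 (R : realType) (p : R) (k0 : nat) :
  1 < p -> (1 < k0)%N -> 0 < fine (level_sum p k0).
Proof.
move=> p1 k01; rewrite -lte_fin fineK ?level_sum_fin_num//.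
exact: level_sum_gt0.
Qed.

Lemma sum_level (R : realType) (p : R) (k0 : nat) : 1 < p -> (1 < k0)%N ->
  (\sum_(k0 <= k <oo) (level p k0 k)%:E = 1)%E.
Proof.
move=> p1 k01.
have -> : (\sum_(k0 <= k <oo) (level p k0 k)%:E =
    (level_const p k0)%:E * level_sum p k0)%E.
  rewrite /level_sum -nneseriesZl//.
  by move=> i _; rewrite lee_fin /level_weight invr_ge0 mulr_ge0 ?powR_ge0.
rewrite /level_const -[X in (_ * X)%E]fineK ?level_sum_fin_num// -EFinM.
by rewrite mulVf// gt_eqF// fine_level_sum_gt0.
Qed.

(** Here ln(1/alpha_k) = ln k + p ln ln k + ln S_p, and the last two terms are negligible against ln
    k. *)
Lemma cvg_ln_level (R : realType) (p : R) (k0 : nat) : 1 < p -> (1 < k0)%N ->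
  ln (1 / level p k0 k) / ln k%:R @[k --> \oo] --> (1 : R).
Proof.
move=> p1 k01; have S0 := fine_level_sum_gt0 p1 k01.
set S := fine _ in S0.
have lnV0 : (ln k%:R : R)^-1 @[k --> \oo] --> (0 : R).
  apply/gtr0_cvgV0; last exact: cvgr_lnn.
  by exists 2%N => // k /= k1; exact: natr_ln_gt0.
have : 1 + p * (ln (ln k%:R) / ln k%:R) + ln S * (ln k%:R)^-1 @[k --> \oo]
    --> (1 + p * 0 + ln S * 0 : R).
  apply: cvgD; last exact: cvgMl_tmp.
  apply: cvgD; first exact: cvg_cst.
  by apply: cvgMl_tmp; apply: cvg_ln_div; exact: cvgr_lnn.
rewrite !mulr0 !addr0; apply: cvg_trans; apply: near_eq_cvg; near=> k.
have k1 : (1 < k)%N by near: k; exists 2%N.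
have kR : 0 < k%:R :> R by rewrite ltr0n ltnW.
have L0 := natr_ln_gt0 R k1.
rewrite /level /level_const /level_weight -/S div1r -invfM invrK.
rewrite !lnM ?posrE ?mulr_gt0 ?powR_gt0// ln_powR.
by field; rewrite gt_eqF.
Unshelve. all: by end_near. Qed.

(** * Counting indices along one path *)

Lemma nneseries_bool_le (R : realType) (b : nat -> bool) (k0 m : nat) :
  (forall k, (m <= k)%N -> ~~ b k) ->
  (\sum_(k0 <= k <oo) ((b k)%:R : R)%:E <= (m%:R : R)%:E)%E.
Proof.
move=> bm; apply: lime_le; first by apply: is_cvg_nneseries => *; rewrite lee_fin.
apply: nearW => n; rewrite sumEFin lee_fin -natr_sum ler_nat.
(* The range is enlarged to [maxn n m] so that it can be cut at n as well as at m. *)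
have : (\sum_(k0 <= k < n) b k <= \sum_(0 <= k < maxn n m) (k < m))%N.
  apply: (@leq_trans (\sum_(k0 <= k < n) (k < m))%N).
    apply: leq_sum => k _; case: ltnP => // mk; first by case: (b k).
    by rewrite (negbTE (bm k mk)).
  have [nk|kn] := leqP n k0; first by rewrite big_geq.
  rewrite (@big_cat_nat _ _ _ n 0)//= ?leq_maxl//.
  rewrite (@big_cat_nat _ _ _ k0 0 n)//= ?(ltnW kn)//.
  by rewrite addnAC leq_addl.
move/leq_trans; apply.
rewrite (@big_cat_nat _ _ _ m)//= ?leq_maxr//.
rewrite [X in (_ + X)%N]big1_seq; last first.
  by move=> k; rewrite mem_index_iota => /andP[_ /andP[mk _]]; rewrite ltnNge mk.
rewrite addn0 (leq_trans (_ : _ <= \sum_(0 <= k < m) 1)%N)//.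
  by apply: leq_sum => k _; case: (k < m)%N.
by rewrite sum_nat_const_nat subn0 muln1.
Qed.

(** The indices in [K, m) already suffice. The difference is taken in [R], so the bound is trivial
    when m <= K. *)
Lemma nneseries_bool_ge (R : realType) (b : nat -> bool) (k0 K m : nat) :
  (k0 <= K)%N -> (forall k, (K <= k < m)%N -> b k) ->
  ((m%:R - K%:R : R)%:E <= \sum_(k0 <= k <oo) ((b k)%:R : R)%:E)%E.
Proof.
move=> k0K bK; apply: le_trans (@nneseries_lim_ge _ _ xpredT k0 m _); last first.
  by move=> *; rewrite lee_fin.
rewrite sumEFin lee_fin -natr_sum lerBlDr -natrD ler_nat.
have [mK|Km] := leqP m K; first by rewrite (leq_trans mK)// leq_addl.
rewrite (@big_cat_nat _ _ _ K)//= ?(ltnW Km)// -addnA addnC.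
rewrite -{1}(subnK (ltnW Km)) -addnA leq_add ?leq_addr//.
rewrite (leq_trans (_ : _ <= \sum_(K <= k < m) 1)%N)//.
  by rewrite sum_nat_const_nat muln1.
by rewrite big_nat [leqRHS]big_nat; apply: leq_sum => k /bK ->.
Qed.

Lemma stop_countE (R : realType) (U : Type) (k0 : nat)
    (tau : nat -> U -> option nat) (t : nat) (w : U) :
  (stop_count R k0 tau t w =
   \sum_(k0 <= k <oo) ((time_le (tau k w) t)%:R : R)%:E)%E.
Proof.
apply: eq_eseriesr => k _; rewrite indicE; congr (_%:R%:E).
by congr nat_of_bool; apply/idP/idP; rewrite inE.
Qed.

(** Deterministic core of the growth rate, for the times n_k of one outcome. For k >= K, (I - D) n_k
    < ln k < (I + D) n_k; hence n_k <= t forces k < exp((I + D) t) and follows from k <= exp((I - D)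
    t). The indices below K are absorbed by a factor exp(D t). *)
Lemma log_count_cvg (R : realType) (I : R) (k0 : nat) (n : nat -> option nat) :
  0 < I -> (\forall k \near \oo, n k <> None) ->
  ln k%:R / (odflt 0 (n k))%:R @[k --> \oo] --> I ->
  ((1 / t%:R)%:E * lne (\sum_(k0 <= k <oo) ((time_le (n k) t)%:R : R)%:E)%E)%E
    @[t --> \oo] --> I%:E.
Proof.
move=> I0 nN nI.
set N := fun t : nat => (\sum_(k0 <= k <oo) ((time_le (n k) t)%:R : R)%:E)%E.
(* A priori [N t] may be 0 or infinite; the witness r records that it is eventually a positive real,
   where [lne] is the real logarithm. *)
suff H e : 0 < e -> \forall t \near \oo, exists2 r : R, N t = r%:E &
    0 < r /\ `|I - 1 / t%:R * ln r| <= e.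
  have Nfin r (t : nat) : N t = r%:E -> 0 < r ->
      ((1 / t%:R)%:E * lne (N t))%E = (1 / t%:R * ln r)%:E.
    by move=> -> r0; rewrite lne_EFin.
  apply/fine_cvgP; split.
    have := H 1 ltr01; apply: filterS => t [r Ntr [r0 _]].
    by rewrite -/(N t) (Nfin r).
  apply/cvgrPdist_le => e /H; apply: filterS => t [r Ntr [r0 er]] /=.
  by rewrite -/(N t) (Nfin r).
move=> e0.
(* The final error in the rate is 2D, hence e/2; the bound I/2 keeps I - 2D nonnegative and I - D
   positive. *)
pose D := Num.min (e / 2) (I / 2).
have D0 : 0 < D by rewrite /D lt_min !divr_gt0.
have De : 2 * D <= e by rewrite mulrC -ler_pdivlMr// ge_min lexx.
have DI : 2 * D <= I by rewrite mulrC -ler_pdivlMr// ge_min lexx orbT.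
clearbody D.
have [K0 _ HK] : \forall k \near \oo, n k <> None /\
    `|I - ln k%:R / (odflt 0 (n k))%:R| < D.
  by apply: filterI nN _; move/cvgrPdist_lt: nI; apply.
pose K := maxn K0 (maxn k0 1).
have HKK k : (K <= k)%N -> exists2 j, n k = Some j &
    (I - D) * j%:R < ln k%:R < (I + D) * j%:R.
  rewrite !geq_max => /andP[/HK[]] /=; case: (n k) => [j _|//] /= Hj _.
  exists j => //; move: Hj; rewrite ltr_distlC => /andP[Hj1 Hj2].
  (* j = 0 is excluded since then the quotient is ln k / 0 = 0 *)
  case: j Hj1 Hj2 => [|j]; first by rewrite invr0 mulr0 => *; lra.
  by rewrite ltr_pdivlMr// ltr_pdivrMr// => -> ->.
have k0K : (k0 <= K)%N by rewrite !leq_max leqnn orbT.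
have K1 : (0 < K)%N by rewrite !leq_max !orbT.
near=> t.
have t0 : 0 < t%:R :> R by near: t; exact: (cvgry_gt cvgr_idn).
(* The factor exp(D t) has to cover the main term, K exceptional indices and one unit of rounding: K
   + 2 in all, since the main exponential is at least 1. *)
have tK : ln (K%:R + 2) <= D * t%:R.
  by rewrite mulrC -ler_pdivrMr//; near: t; exact: (cvgry_ge cvgr_idn).
have {}tK : K%:R + 2 <= expR (D * t%:R).
  by rewrite -ler_expR lnK ?posrE// in tK; rewrite ltr_wpDl.
have upper : (N t <= (expR ((I + 2 * D) * t%:R))%:E)%E.
  apply: (@le_trans _ _
    ((K + (Num.truncn (expR ((I + D) * t%:R))).+1)%N%:R : R)%:E).
    apply: nneseries_bool_le => k Hk.
    have [j -> /andP[_ Hj]] := HKK k (leq_trans (leq_addr _ _) Hk).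
    rewrite /= -ltnNge -(ltr_nat R) -(@ltr_pM2l _ (I + D)); last by lra.
    apply: le_lt_trans Hj; rewrite -(expRK ((I + D) * t%:R)).
    have {}Hk := leq_trans (leq_addl _ _) Hk.
    have k_gt0 : (0 < k)%N by exact: leq_trans Hk.
    rewrite ler_ln ?posrE ?expR_gt0 ?ltr0n//.
    by move: Hk; rewrite truncn_lt_nat ?expR_ge0// => /ltW.
  rewrite lee_fin natrD.
  have -> : (I + 2 * D) * t%:R = (I + D) * t%:R + D * t%:R by ring.
  rewrite expRD -natr1.
  have : (Num.truncn (expR ((I + D) * t%:R)))%:R <= expR ((I + D) * t%:R).
    by rewrite truncn_le expR_ge0.
  have : 1 <= expR ((I + D) * t%:R).
    by rewrite -[leLHS]expR0 ler_expR; apply: mulr_ge0; [lra|exact: ltW].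
  have : 0 <= K%:R :> R by [].
  by nra.
have lower : ((expR ((I - 2 * D) * t%:R))%:E <= N t)%E.
  apply: (@le_trans _ _
    ((Num.truncn (expR ((I - D) * t%:R)))%:R - K%:R : R)%:E); last first.
    apply: nneseries_bool_ge => // k /andP[Kk Hk].
    have [j -> /andP[Hj _]] := HKK k Kk.
    rewrite /= -(ler_nat R) -(@ler_pM2l _ (I - D)); last by lra.
    apply: le_trans (ltW Hj) _; rewrite -(expRK ((I - D) * t%:R)).
    rewrite ler_ln ?posrE ?expR_gt0 ?ltr0n ?(leq_trans K1)//.
    by move: (ltnW Hk); rewrite truncn_ge_nat ?expR_ge0.
  rewrite lee_fin.
  have /andP[_] := truncn_itv (expR_ge0 ((I - D) * t%:R)).
  rewrite -natr1.
  have -> : (I - D) * t%:R = (I - 2 * D) * t%:R + D * t%:R by ring.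
  rewrite expRD.
  have : 1 <= expR ((I - 2 * D) * t%:R).
    by rewrite -[leLHS]expR0 ler_expR; apply: mulr_ge0; [lra|exact: ltW].
  have : 0 <= K%:R :> R by [].
  by nra.
have Nfin : N t \is a fin_num.
  rewrite ge0_fin_numE; first exact: le_lt_trans upper (ltry _).
  by apply: le_trans lower; rewrite lee_fin expR_ge0.
move: upper lower; rewrite -(fineK Nfin) !lee_fin => upper lower.
have r0 : 0 < fine (N t) by apply: lt_le_trans lower; exact: expR_gt0.
exists (fine (N t)) => //; split => //.
rewrite ler_distlC div1r mulrC ler_pdivlMr// ler_pdivrMr//.
apply/andP; split.
  rewrite -[leLHS]expRK ler_ln ?posrE ?expR_gt0//; apply: le_trans lower.
  by rewrite ler_expR ler_pM2r//; lra.
rewrite -[leRHS]expRK ler_ln ?posrE ?expR_gt0//; apply: le_trans upper _.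
by rewrite ler_expR ler_pM2r//; lra.
Unshelve. all: by end_near. Qed.

Local Open Scope ereal_scope.

(** * Adaptedness, and the expectation at a finite stopping time *)

Section stopping.
Context (R : realType) (d : measure_display) (T : measurableType d).
Variables (F : nat -> set (set T)) (k0 : nat) (tau : nat -> T -> option nat).
Hypothesis F_filtration : filtration F.
Hypothesis tau_stopping :
  forall k, (k0 <= k)%N -> stopping_time F (tau k).

(** Summing from 0 makes every term a genuine stopping-time indicator; nothing is assumed of [tau k]
    for k < k0. *)
Lemma stop_count_shift (t : nat) (w : T) : stop_count R k0 tau t w =
  \sum_(0 <= k <oo) (\1_[set v | time_le (tau (k + k0)%N v) t] w)%:E.
Proof.
by rewrite (nneseries_addn k0
  (f := fun k => (\1_[set v | time_le (tau k v) t] w)%:E)).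
Qed.

Lemma stop_count_adapted : adapted F (stop_count R k0 tau).
Proof.
move=> t A mA; have [sF _ _] := F_filtration.
(* [F t] is a bare family of sets; the type it generates carries the same sigma-algebra and gives
   access to measurability of series. *)
suff : measurable_fun [set: g_sigma_algebraType (F t)] (stop_count R k0 tau t).
  move=> /(_ measurableT A mA); rewrite setTI.
  by rewrite /measurable/= sigma_algebra_id.
rewrite (_ : stop_count R k0 tau t =
  fun w => \sum_(0 <= k <oo) (\1_[set v | time_le (tau (k + k0)%N v) t] w)%:E);
  last by apply/funext => w; exact: stop_count_shift.
apply: (@ge0_emeasurable_sum _ (g_sigma_algebraType (F t)) R setT
  (fun k w => (\1_[set v | time_le (tau (k + k0)%N v) t] w)%:E) xpredT).
  by move=> *; rewrite lee_fin.
move=> k _; apply/measurable_EFinP; apply: measurable_indic.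
by apply: sub_sigma_algebra; apply: tau_stopping; exact: leq_addl.
Qed.

(** The event is the union over t of {x <= t <= sigma}, with t <= sigma written as the failure of
    sigma <= s for all s < t, so that only events given by the stopping-time property occur. *)
Lemma measurable_time_le_stop (x : T -> option nat) (sigma : T -> nat) :
  stopping_time F x -> stopping_time F (Some \o sigma) ->
  measurable [set w | time_le (x w) (sigma w)].
Proof.
move=> xF sF; have [_ mF _] := F_filtration.
rewrite (_ : [set w | _] = \bigcup_t ([set w | time_le (x w) t] `&`
    \bigcap_(s in [set s | (s < t)%N]) ~` [set w | (sigma w <= s)%N])).
  apply: bigcupT_measurable => t; apply: measurableI; first exact/mF/xF.
  by apply: bigcap_measurableType => s _; apply: measurableC; exact/mF/sF.
apply/seteqP; split => [w /= xw|w [t _ [/= xt ts]]].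
  by exists (sigma w) => //; split => // s /= ss; rewrite leqNgt ss.
have ts' : (t <= sigma w)%N.
  by rewrite leqNgt; apply/negP => st; exact: (ts (sigma w) st (leqnn _)).
by move: xt; case: (x w) => //= m /leq_trans; apply.
Qed.

Lemma measurable_stop_finite (x : T -> option nat) : stopping_time F x ->
  measurable [set w | x w <> None].
Proof.
move=> xF; have [_ mF _] := F_filtration.
rewrite (_ : [set w | _] = \bigcup_t [set w | time_le (x w) t]).
  by apply: bigcupT_measurable => t; exact/mF/xF.
apply/seteqP; split => [w /=|w [t _ /=]]; last by case: (x w).
by case E: (x w) => [m|//] _; exists m => //=; rewrite E /=.
Qed.

Lemma expectation_stop_count_le (P : probability T R) (sigma : T -> nat)
    (a : nat -> R) :
  stopping_time F (Some \o sigma) -> (forall k, (0 <= a k)%R) ->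
  (forall k, (k0 <= k)%N -> P [set w | tau k w <> None] <= (a k)%:E) ->
  \int[P]_w stop_count R k0 tau (sigma w) w <= \sum_(k0 <= k <oo) (a k)%:E.
Proof.
move=> sF a0 Pa.
have mtau k : measurable [set w | time_le (tau (k + k0)%N w) (sigma w)].
  by apply: measurable_time_le_stop => //; apply: tau_stopping; exact: leq_addl.
under eq_integral do rewrite stop_count_shift.
(* The set under the indicator depends on w through [sigma w]. Replacing it by the set with
   [sigma v] leaves the value at w unchanged and makes each term the indicator of a fixed event. *)
rewrite (_ : (fun w => _) = fun w => \sum_(0 <= k <oo)
    (\1_[set v | time_le (tau (k + k0)%N v) (sigma v)] w)%:E); last first.
  apply/funext => w; apply: eq_eseriesr => k _; rewrite !indicE.
  by congr (_%:R%:E); congr nat_of_bool; apply/idP/idP; rewrite !inE.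
rewrite integral_nneseries//; last first.
  by move=> k; apply/measurable_EFinP; exact: measurable_indic.
rewrite -(nneseries_addn k0 (f := fun k => (a k)%:E)); last first.
  by move=> k; rewrite lee_fin.
apply: lee_nneseries => k _.
  by move=> _; apply: integral_ge0 => w _; rewrite lee_fin.
rewrite integral_indic// setIT.
(* As sigma is finite, tau_k <= sigma implies tau_k < oo. *)
apply: le_trans (Pa _ (leq_addl _ _)); apply: le_measure; rewrite ?inE//.
  by apply: measurable_stop_finite; apply: tau_stopping; exact: leq_addl.
by move=> w /=; case: (tau _ w).
Qed.

End stopping.

(** * From the assumed asymptotics to the theorem *)

Lemma level_ge0 (R : realType) (p : R) (k0 k : nat) : (0 <= level p k0 k)%R.
Proof.
have w0 j : (0 <= level_weight p j)%R.
  by rewrite /level_weight invr_ge0 mulr_ge0 ?powR_ge0.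
rewrite /level mulr_ge0// /level_const invr_ge0 fine_ge0//.
by apply: nneseries_ge0 => j _ _; rewrite lee_fin.
Qed.

(** The limit 1/I is finite, while an infinite time over the eventually positive ln(1/alpha_k) is
    infinite; so the times are eventually finite and the default in [odflt] does not affect the
    limit. Multiplying by ln(1/alpha_k) / ln k, which tends to 1, and inverting gives the limit
    I. *)
Lemma stop_time_ratio_cvg (R : realType) (I p : R) (k0 : nat)
    (n : nat -> option nat) :
  (0 < I)%R -> (1 < p)%R -> (1 < k0)%N ->
  time_EFin R (n k) / (ln (1 / level p k0 k)%R)%:E
    @[k --> \oo] --> (1 / I)%R%:E ->
  (\forall k \near \oo, n k <> None) /\
  (ln k%:R / (odflt 0%N (n k))%:R)%R @[k --> \oo] --> I.
Proof.
move=> I0 p1 k01 /fine_cvgP[nfin ncvg].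
have acvg := cvg_ln_level p1 k01.
have a0 : \forall k \near \oo, (0 < ln (1 / level p k0 k))%R.
  near=> k.
  have : (0 < ln (1 / level p k0 k) / ln k%:R)%R.
    by near: k; exact: (cvgr_gt _ acvg _ ltr01).
  by rewrite pmulr_lgt0// invr_gt0 natr_ln_gt0//; near: k; exists 2%N.
have nN : \forall k \near \oo, n k <> None.
  near=> k => nk.
  have a0k : (0 < ln (1 / level p k0 k))%R by near: k.
  have : time_EFin R (n k) / (ln (1 / level p k0 k)%R)%:E \is a fin_num.
    by near: k.
  by rewrite nk /= inver gt_eqF// gt0_mulye// lte_fin invr_gt0.
split => //.
have IV0 : (I^-1 != 0)%R by rewrite gt_eqF// invr_gt0.
have ivcvg : ((fine (time_EFin R (n k) / (ln (1 / level p k0 k)%R)%:E) *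
    (ln (1 / level p k0 k) / ln k%:R))^-1)%R @[k --> \oo] --> I.
  rewrite -[I]invrK; apply: cvgV IV0 _.
  by rewrite -[I^-1%R]mulr1 -(div1r I); apply: cvgM.
apply: cvg_trans ivcvg; apply: near_eq_cvg; near=> k.
have a0k : (0 < ln (1 / level p k0 k))%R by near: k.
have : n k <> None by near: k.
rewrite /=; case: (n k) => // j _ /=.
by rewrite inver gt_eqF//= mulrA mulfVK ?gt_eqF// invf_div.
Unshelve. all: by end_near. Qed.

Unset Implicit Arguments.

Theorem corollaryD3 (R : realType) (d : measure_display)
    (T : measurableType d) (F : nat -> set (set T))
    (PP : set (probability T R)) (Q : probability T R)
    (I p : R) (k0 : nat) (tau : nat -> T -> option nat)
    (F_filtration : filtration F)
    (I_gt0 : (0 < I)%R) (p_gt1 : (1 < p)%R) (k0_ge3 : (3 <= k0)%N)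
    (tau_stopping : forall k, (k0 <= k)%N -> stopping_time F (tau k))
    (tau_level : forall k, (k0 <= k)%N ->
      ereal_sup [set P [set w | tau k w <> None]
                | P in (PP : set (probability T R))] <= (level p k0 k)%:E)
    (tau_asymp : {ae Q, forall w,
      time_EFin R (tau k w) / (ln (1 / level p k0 k)%R)%:E
        @[k --> \oo] --> (1 / I)%R%:E}) :
  [/\ level_sum p k0 < +oo,
      e_process F PP (stop_count R k0 tau) &
      {ae Q, forall w,
        ((1 / t%:R)%R)%:E * lne (stop_count R k0 tau t w)
          @[t --> \oo] --> I%:E}].
Proof.
have k01 : (1 < k0)%N by rewrite ltnW.
split.
- by rewrite ltey_eq level_sum_fin_num.
- split; first by move=> t w; apply: nneseries_ge0 => *; rewrite lee_fin.
    exact: stop_count_adapted.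
  move=> P PPP sigma sF; rewrite -(sum_level p_gt1 k01).
  apply: (expectation_stop_count_le F_filtration tau_stopping sF).
    by move=> k; exact: level_ge0.
  move=> k k0k; apply: le_trans (tau_level k k0k).
  by apply: ereal_sup_ubound; exists P.
(* The exceptional null set is that of the hypothesis; off it the argument is pathwise. *)
- apply: filterS tau_asymp => w /(stop_time_ratio_cvg I_gt0 p_gt1 k01)[nN nI].
  apply: cvg_trans (log_count_cvg k0 I_gt0 nN nI).
  by apply: near_eq_cvg; apply: nearW => t; rewrite stop_countE.
Qed.
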